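(* If $G\sim G_{n,n,\frac12}$ then $G$ is Hamiltonian with probability $1-2^{-(1+o(1))n}$.
   Context: $G_{n,m,\frac12}$ denotes a random bipartite graph with colour classes of sizes $n$ and $m$, in which each of the $nm$ possible edges between the classes is present independently with probability $1/2$. *)

(* Defs.v *)
From HB Require Import structures.
From mathcomp Require Import all_boot all_order all_algebra.
From mathcomp Require Import all_classical all_reals all_analysis.

Set Implicit Arguments.
Unset Strict Implicit.
Unset Printing Implicit Defensive.

Import Order.TTheory GRing.Theory Num.Theory.
Import numFieldNormedType.Exports.

Local Open Scope ring_scope.

(* A bipartite graph with labelled colour classes 'I_n and 'I_m is given by
   its edge set: (i, j) stands for the edge joining inl i and inr j. *)
Definition bigraph (n m : nat) : finType := {set 'I_n * 'I_m}.

Definition bigraph_adj (n m : nat) (G : bigraph n m) : rel ('I_n + 'I_m) :=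
  fun u v => match u, v with
             | inl i, inr j => (i, j) \in G
             | inr j, inl i => (i, j) \in G
             | _, _ => false
             end.

(* The condition 2 < #|T| excludes the closed walk x, y, x through a single
   edge (and the empty sequence), which [cycle] accepts. *)
Definition hamiltonian (T : finType) (e : rel T) : bool :=
  (2 < #|T|)%N && [exists c : #|T|.-tuple T, ucycleb e c].

(* Probability of the outcome G in G_{n,m,p}: the product measure over the
   n * m potential edges. *)
Definition bigraph_weight (R : realType) (n m : nat) (p : R)
    (G : bigraph n m) : R :=
  \prod_(e : 'I_n * 'I_m) (if e \in G then p else 1 - p).

Definition bigraph_prob (R : realType) (n m : nat) (p : R)
    (A : pred (bigraph n m)) : R :=
  \sum_(G : bigraph n m | A G) bigraph_weight p G.

Lemma bigraph_prob_total (R : realType) (n m : nat) (p : R) :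
  bigraph_prob p (fun _ : bigraph n m => true) = 1.
Proof.
rewrite /bigraph_prob /bigraph_weight -(bigA_distr _ _ (fun=> p) (fun=> 1 - p)).
by apply: big1 => e _; rewrite [LHS]addrC subrK.
Qed.

(* Main.v *)
From mathcomp Require Import all_boot.
Require Import Defs.

(** An isolated vertex occurs with probability at least [2^-n], which bounds
    the failure probability from below.  For the upper bound take [s] of order
    [sqrt n].  Up to probability [2^(-n + o(n))] every vertex has degree at
    least [2 s], and any two sets of [s] vertices from opposite classes are
    joined by an edge.  These two properties force Hamiltonicity.  They survive
    adding edges, so by induction on the number of missing edges there is a
    Hamiltonian path [v_0, ..., v_N], with [x = v_0] and [y = v_N] in opposite
    classes.  If [x ~ v_i] and [v_j ~ y], then the path closes up through
    [v_(i-1) ~ v_(j+1)] when [i < j], and through [v_(j-1) ~ v_(i+1)] when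
    [j < i].  Cutting the path just after the [s]-th neighbour of [x] leaves
    [s] candidates for both ends in one of these two configurations. *)

(** * Reversing and splitting paths; neighbours along a path *)

Lemma path_rev_sym {T : Type} {e : rel T} {x : T} {p : seq T} :
  symmetric e -> path e x p -> path e (last x p) (rev (belast x p)).
Proof.
by move=> e_sym; rewrite rev_path; apply: sub_path => u v; rewrite e_sym.
Qed.

Lemma last_rev_belast {T : Type} (x : T) (p : seq T) :
  last (last x p) (rev (belast x p)) = x.
Proof. by case: p => //= y p; rewrite rev_cons last_rcons. Qed.

Lemma rev_cons_belast {T : Type} (x : T) (p : seq T) :
  rev (x :: p) = last x p :: rev (belast x p).
Proof. by rewrite lastI rev_rcons. Qed.

Lemma index_lt_split {T : eqType} {u w : T} {s : seq T} :
  index u s < index w s -> w \in s ->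
  exists p1 p2 p3, s = p1 ++ u :: p2 ++ w :: p3.
Proof.
elim: s => //= z s IHs; case: (eqVneq z u) => [<-|zu].
  case: (eqVneq z w) => // zw _; rewrite inE eq_sym (negPf zw) /=.
  by case/splitPr=> p2 p3; exists [::], p2, p3.
case: (eqVneq z w) => // zw; rewrite ltnS inE eq_sym (negPf zw) /= => lt ws.
by have [p1 [p2 [p3 ->]]] := IHs lt ws; exists (z :: p1), p2, p3.
Qed.

Lemma prev_split {T : eqType} {x u : T} {p q : seq T} :
  uniq (x :: p ++ u :: q) -> prev (x :: p ++ u :: q) u = last x p.
Proof.
rewrite cons_uniq cat_uniq [has _ (u :: _)]/= negb_or =>
  /and4P[_ _ /andP[up _] _].
rewrite prev_nth !inE mem_cat mem_head !orbT index_cat (negPf up) index_head.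
rewrite addn0 -cat_cons nth_cat ltnS leqnn; exact: (nth_last x (x :: p)).
Qed.

Lemma next_split {T : eqType} {x u v : T} {p q : seq T} :
  uniq (x :: p ++ u :: v :: q) -> next (x :: p ++ u :: v :: q) u = v.
Proof.
move=> Us; have up : u \notin x :: p.
  move: Us; rewrite -cat_cons cat_uniq [has _ (u :: _)]/= negb_or.
  by case/and3P=> _ /andP[].
rewrite next_nth -cat_cons mem_cat mem_head orbT index_cat (negPf up).
by rewrite index_head addn0 nth_cat /= ltnNge leqnSn /= subSnn.
Qed.

Lemma path_prev {T : eqType} {e : rel T} {x u : T} {p : seq T} :
  path e x p -> uniq (x :: p) -> u \in p -> e (prev (x :: p) u) u.
Proof.
move=> ep Up up; case/splitPr: up ep Up => p1 p2.
by rewrite cat_path [path _ _ (_ :: _)]/= => /and3P[_ ? _] Up;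
  rewrite prev_split.
Qed.

Lemma path_next {T : eqType} {e : rel T} {x u : T} {p : seq T} :
  path e x p -> uniq (x :: p) -> u \in x :: p -> u != last x p ->
  e u (next (x :: p) u).
Proof.
move=> ep Up; rewrite inE => /predU1P[->{u}|up].
  by case: p ep Up => [|y p] /=; rewrite ?eqxx // => /andP[].
case/splitPr: up ep Up => p1 [|v p2]; first by rewrite last_cat /= eqxx.
rewrite cat_path [path _ _ (_ :: _)]/= => /and4P[_ _ ? _] Up _.
by rewrite next_split.
Qed.

(** * Closing a Hamiltonian path into a cycle *)

(** The case [i < j]: walk from [a] to the end of [p2], jump to the end of the path, return to [c],
    jump to the end of [x :: p1], return to [x], and close by [x ~ a]. Both outer segments are
    reversed. *)
Lemma cycle_flip_ends {T : Type} {e : rel T} {x a c : T} {p1 p2 p3 : seq T} :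
    symmetric e -> path e x (p1 ++ a :: p2 ++ c :: p3) ->
    e x a -> e (last a p2) (last c p3) -> e (last x p1) c ->
  cycle e (a :: p2 ++ rev (c :: p3) ++ rev (x :: p1)).
Proof.
move=> e_sym; rewrite cat_path /= cat_path /=.
move=> /and5P[e1 _ e2 _ e3] exa eac e1c.
rewrite rcons_cat cat_path e2 /= rcons_cat !rev_cons_belast /= eac /=.
rewrite cat_path path_rev_sym //= last_rev_belast e_sym e1c /=.
by rewrite rcons_path path_rev_sym // last_rev_belast.
Qed.

(** The case [j < i]: the last two segments trade places and every segment keeps its direction. *)
Lemma cycle_swap_tail {T : Type} {e : rel T} {x a c : T} {p1 p2 p3 : seq T} :
    path e x (p1 ++ a :: p2 ++ c :: p3) ->
    e (last x p1) c -> e (last c p3) a -> e (last a p2) x ->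
  cycle e (x :: p1 ++ (c :: p3) ++ (a :: p2)).
Proof.
rewrite cat_path /= cat_path /= => /and5P[e1 _ e2 _ e3] e1c eca eax.
by rewrite rcons_cat cat_path e1 /= e1c rcons_cat cat_path e3 /= eca rcons_path
  e2.
Qed.

(** Raising the threshold just past the least remaining value of [f] admits exactly one new element,
    by injectivity. With [f] the position on the path, this provides the cut after the [s]-th
    neighbour of [x]. *)
Lemma threshold_count {T : finType} {f : T -> nat} {A : {set T}} {s : nat} :
  s <= #|A| -> injective f -> exists a, #|[set v in A | f v < a]| = s.
Proof.
move=> sA f_inj; elim: s sA => [_|s IHs sA].
  exists 0; apply/eqP; rewrite cards_eq0; apply/eqP/setP=> v.
  by rewrite !inE ltn0 andbF.
have [a Ea] := IHs (ltnW sA).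
have /subsetPn[v0 v0A v0a] : ~~ (A \subset [set v in A | f v < a]).
  by apply/negP=> /subset_leq_card; rewrite Ea leqNgt sA.
have v0P : [pred v | (v \in A) && (a <= f v)] v0.
  by move: v0a; rewrite /= !inE v0A -leqNgt.
case: (arg_minnP f v0P) => v /= /andP[vA lev] minv; exists (f v).+1.
suff -> : [set u in A | f u < (f v).+1] = v |: [set u in A | f u < a].
  by rewrite cardsU1 Ea !inE ltnNge lev /= andbF.
apply/setP=> u; rewrite !inE ltnS; case: (eqVneq u v) => [->|uv] /=.
  by rewrite vA leqnn.
case uA: (u \in A) => //=; apply/idP/idP => [le|/ltnW/leq_trans->//].
rewrite ltnNge; apply/negP => leau; case/eqP: uv; apply: f_inj.
by apply/eqP; rewrite eqn_leq le minv // uA.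
Qed.

(** The predicate [col] marks the class of [y]. Moving one step along the path changes class, so
    predecessors of neighbours of one end and successors of neighbours of the other lie in opposite
    classes, where the edge between large sets applies. *)
Lemma hamiltonian_path_close {T : finType} {e : rel T} {col : pred T}
    {s : nat} {x : T} {p : seq T} :
    symmetric e -> (forall u v, e u v -> col u != col v) ->
    ~~ col x -> col (last x p) ->
    (forall A B : {set T}, s <= #|A| -> s <= #|B| ->
       (forall a, a \in A -> ~~ col a) -> (forall b, b \in B -> col b) ->
       exists a b, [/\ a \in A, b \in B & e a b]) ->
    2 * s <= #|[set v | e x v]| -> 2 * s <= #|[set v | e (last x p) v]| ->
    path e x p -> uniq (x :: p) -> (forall v, v \in x :: p) ->
  exists c, perm_eq c (x :: p) /\ cycle e c.
Proof.
move=> e_sym e_col colx coly no_hole degx degy ep Up allp.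
set q := x :: p in Up allp *; set y := last x p in coly degy *.
(* If [x ~ y] the path closes at once. Otherwise no neighbour of either end is an end, so the steps
   by [prev] and [next] below never wrap around. *)
have [exy|exy] := boolP (e x y).
  by exists q; split; rewrite //= rcons_path ep e_sym.
set X := [set v | e x v] in degx; set Y := [set v | e y v] in degy.
have XP v : v \in X -> [/\ e x v, col v, v != x & v != y].
  rewrite inE => exv; move: (e_col _ _ exv); rewrite (negPf colx) => colv.
  have {}colv : col v by case: (col v) colv.
  split=> //; first by apply: contraNneq colx => <-.
  by apply: contraNneq exy => <-.
have YP v : v \in Y -> [/\ e v y, ~~ col v, v != x & v != y].
  rewrite inE e_sym => evy; move: (e_col _ _ evy); rewrite coly => colv.
  have {}colv : ~~ col v by case: (col v) colv.
  split=> //; first by apply: contraNneq exy => <-.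
  by apply: contraNneq colv => ->.
have xp v : v != x -> v \in p.
  by move=> vx; have := allp v; rewrite inE (negPf vx).
have prev_inj : injective (prev q) := can_inj (next_prev Up).
have next_inj : injective (next q) := can_inj (prev_next Up).
have idx_inj : injective (fun v => index v q).
  by move=> u v Euv; rewrite -(nth_index x (allp u)) Euv nth_index.
(* As [u] is not the first vertex and [w] not the last, both the predecessor of [u] and the
   successor [c] of [w] exist on the path. *)
have split u w : index u q < index w q -> u != x -> w != y ->
    exists p1 p2 c p3, p = p1 ++ u :: p2 ++ w :: c :: p3.
  move=> ltuw ux wy; have [[|z p1] [p2 [p3 Eq]]] := 
    index_lt_split ltuw (allp w).
    by case: Eq ux => <-; rewrite eqxx.
  case: Eq => _ Ep; case: p3 Ep => [|c p3] Ep; last by exists p1, p2, c, p3.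
  by move: wy; rewrite /y Ep last_cat /= last_cat /= eqxx.
have sX : s <= #|X| by rewrite (leq_trans _ degx) // leq_pmull.
have [a Xa] := threshold_count sX idx_inj.
have prev_col v : v != x -> col (prev q v) != col v.
  by move=> vx; rewrite e_col // path_prev // xp.
have next_col v : v != y -> col (next q v) != col v.
  by move=> vy; rewrite eq_sym e_col // path_next.
(* Either [s] neighbours of [y] lie at or after the cut, beyond [s] neighbours of [x], or at least
   [s] of them lie before it. *)
have [Ya|Ya] := leqP s #|[set v in Y | a <= index v q]|.
  have [||||u0 [w0 [/imsetP[u uX ->] /imsetP[w wY ->] euw]]] :=
    no_hole (prev q @: [set v in X | index v q < a])
            (next q @: [set v in Y | a <= index v q]).
  - by rewrite card_imset // Xa.
  - by rewrite card_imset.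
  - move=> _ /imsetP[v + ->]; rewrite inE => /andP[/XP[_ colv vx _] _].
    by have := prev_col _ vx; rewrite colv; case: (col _).
  - move=> _ /imsetP[v + ->]; rewrite inE => /andP[/YP[_ colv _ vy] _].
    by have := next_col _ vy; rewrite (negPf colv); case: (col _).
  move: uX wY; rewrite inE => /andP[/XP[exu _ ux _] ltu].
  rewrite inE => /andP[/YP[ewy _ _ wy] lew].
  have [p1 [p2 [c [p3 Ep]]]] := split u w (leq_trans ltu lew) ux wy.
  have Eu : prev q u = last x p1 by rewrite /q Ep prev_split // -Ep.
  have Ew : next q w = c.
    by move: Up; rewrite /q Ep -cat_rcons catA => Up; rewrite next_split.
  rewrite Eu Ew in euw.
  exists (u :: rcons p2 w ++ rev (c :: p3) ++ rev (x :: p1)); split.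
    rewrite perm_sym /q Ep -cat_cons -cat_cons perm_catC -cat_rcons -cat_cons.
    by rewrite -catA perm_cat2l perm_cat // perm_sym perm_rev.
  apply: cycle_flip_ends; rewrite ?last_rcons ?cat_rcons -?Ep //.
  by move: ewy; rewrite /y Ep !(last_cat, last_cons).
have card_split (Z : {set T}) :
    #|[set v in Z | a <= index v q]| + #|[set v in Z | index v q < a]| = #|Z|.
  rewrite -(cardsID [set v | a <= index v q] Z); congr (_ + _).
    by apply: eq_card => v; rewrite !inE.
  by apply: eq_card => v; rewrite !inE -ltnNge andbC.
(* Now the roles are exchanged: at least [2 * s - s] neighbours of [x] lie at or after the cut, and
   at least [s] neighbours of [y] before it. *)
have [||||w0 [u0 [/imsetP[w wX ->] /imsetP[u uY ->] ewu]]] :=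
    no_hole (next q @: [set v in X | a <= index v q])
            (prev q @: [set v in Y | index v q < a]).
- rewrite card_imset // -(leq_add2r s) -[X in _ <= _ + X]Xa card_split.
  by rewrite addnn -mul2n.
- rewrite card_imset // -(leq_add2l s) addnn -mul2n (leq_trans degy) //.
  by rewrite -card_split leq_add2r ltnW.
- move=> _ /imsetP[v + ->]; rewrite inE => /andP[/XP[_ colv _ vy] _].
  by have := next_col _ vy; rewrite colv; case: (col _).
- move=> _ /imsetP[v + ->]; rewrite inE => /andP[/YP[_ colv vx _] _].
  by have := prev_col _ vx; rewrite (negPf colv); case: (col _).
move: wX uY; rewrite inE => /andP[/XP[exw _ _ wy] lew].
rewrite inE => /andP[/YP[euy _ ux _] ltu].
have [p1 [p2 [c [p3 Ep]]]] := split u w (leq_trans ltu lew) ux wy.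
have Eu : prev q u = last x p1 by rewrite /q Ep prev_split // -Ep.
have Ew : next q w = c.
  by move: Up; rewrite /q Ep -cat_rcons catA => Up; rewrite next_split.
rewrite Eu Ew e_sym in ewu.
exists (x :: p1 ++ (c :: p3) ++ (u :: rcons p2 w)); split.
  by rewrite /q Ep perm_cons perm_cat2l -cat_rcons -cat_cons perm_catC.
apply: cycle_swap_tail; rewrite ?last_rcons ?cat_rcons -?Ep // 1?e_sym //.
by move: euy; rewrite /y Ep !(last_cat, last_cons).
Qed.

(** * Removing one edge from a cycle *)

Lemma path_drop_end_edge {T : eqType} {e e' : rel T} {x y : T} {p : seq T} :
    (forall u v, e' u v ->
       [|| e u v, (u == x) && (v == y) | (u == y) && (v == x)]) ->
    uniq (x :: rcons p y) -> p != [::] -> path e' x (rcons p y) ->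
  path e x (rcons p y).
Proof.
case: p => // a p e'e + _; rewrite /= !rcons_path rcons_uniq !inE !mem_rcons
  !inE.
rewrite !negb_or -!andbA => /and5P[xa xy xp ya /and3P[_ yp _]]
  /and3P[e'xa e'p e'y].
have ne u v : e' u v -> (u != x) && (u != y) || (v != x) && (v != y) -> e u v.
  move=> /e'e /or3P[//|/andP[/eqP-> /eqP->]|/andP[/eqP-> /eqP->]];
  by rewrite !eqxx ?andbF.
have xyP u : u \in a :: p -> (u != x) && (u != y).
  rewrite inE => /predU1P[->|up]; first by rewrite eq_sym xa ya.
  apply/andP; split; first by apply: contraNneq xp => <-.
  by apply: contraNneq yp => <-.
apply/and3P; split.
- by apply: ne => //; rewrite (xyP a) ?orbT ?mem_head.
- apply: (sub_in_path (P := mem (a :: p))) e'p; last by apply/allP.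
  by move=> u v uP _ /ne; apply; rewrite (xyP u).
- by apply: ne => //; rewrite (xyP (last a p)) // mem_last.
Qed.

(** The vertices [x] and [y] cut the cycle into two arcs. If both have interior vertices, neither
    uses the edge [xy]. If one has none, the other does because the cycle has more than two
    vertices, and it is the required path, up to reversal. *)
Lemma cycle_drop_edge {T : eqType} {e e' : rel T} {x y : T} {c : seq T} :
    symmetric e -> x != y -> x \in c -> y \in c -> 2 < size c -> uniq c ->
    (forall u v, e' u v ->
       [|| e u v, (u == x) && (v == y) | (u == y) && (v == x)]) ->
    cycle e' c ->
  cycle e c \/ exists p, [/\ path e x p, last x p = y & perm_eq (x :: p) c].
Proof.
move=> e_sym xy xc yc c_gt2 Uc e'e e'c.
have [i p Ec] := rot_to xc.
rewrite -(rot_uniq i) Ec in Uc; rewrite -(rot_cycle i) Ec in e'c.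
rewrite -(size_rot i) Ec in c_gt2;
  rewrite -(mem_rot i) Ec inE eq_sym (negPf xy) /= in yc.
have pc : perm_eq (x :: p) c by rewrite -Ec perm_rot.
rewrite -(rot_cycle i) Ec.
case/splitPr: yc Uc e'c c_gt2 pc {Ec} => p1 p2 Uc.
have Up1 : uniq (x :: rcons p1 y).
  by move: Uc; rewrite -cat_rcons -cat_cons cat_uniq => /and3P[].
have Up2 : uniq (y :: rcons p2 x).
  move: Uc; rewrite -cat_cons uniq_catC cat_cons -cat_rcons.
  by rewrite -cat_cons cat_uniq => /and3P[].
rewrite /cycle rcons_cat rcons_cons -cat_rcons !cat_path last_rcons.
case/andP=> e'p1 e'p2 p12 pc.
have ep1 : p1 != [::] -> path e x (rcons p1 y).
  by move=> p1n; apply: path_drop_end_edge e'p1.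
have ep2 : p2 != [::] -> path e y (rcons p2 x).
  by move=> p2n; apply: path_drop_end_edge e'p2 => // u v /e'e;
    rewrite [X in _ || X]orbC.
case: (eqVneq p1 [::]) => [p10|/ep1{}ep1].
  right; exists (rev (belast y (rcons p2 x))); move: p12 pc;
    rewrite {}p10 => p12 pc.
  have {}ep2 : path e y (rcons p2 x) by apply: ep2; case: (p2) p12.
  have := path_rev_sym e_sym ep2; have := rev_cons_belast y (rcons p2 x).
  have := last_rev_belast y (rcons p2 x); rewrite last_rcons => -> <- ep.
  split=> //; apply: perm_trans pc.
  rewrite perm_rev -rcons_cons perm_rcons; exact: perm_refl.
case: (eqVneq p2 [::]) pc => [-> pc|/ep2{}ep2 _].
  by right; exists (rcons p1 y); rewrite cats1 in pc; rewrite last_rcons.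
by left; apply/andP.
Qed.

(** * A deterministic criterion for Hamiltonicity *)

Lemma hamiltonianP (T : finType) (e : rel T) :
  reflect (2 < #|T| /\ exists c, [/\ cycle e c, uniq c & forall v, v \in c])
          (hamiltonian e).
Proof.
apply: (iffP andP) => -[T_gt2 H]; split=> //.
  have [c /andP[ec Uc]] := existsP H; exists c; split=> // v.
  have /subset_cardP : #|c| = #|T| by rewrite (card_uniqP Uc) size_tuple.
  by move/(_ (subset_predT _))->.
have [c [ec Uc allc]] := H.
have Ec : size c == #|T|.
  by rewrite -(card_uniqP Uc) (eq_card (B := T)) // => v; rewrite allc.
by apply/existsP; exists (Tuple Ec); rewrite /ucycleb ec Uc.
Qed.

Lemma bigraph_adj_sym (n m : nat) (G : bigraph n m) : symmetric (bigraph_adj G).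
Proof. by case=> [i|i] [j|j]. Qed.

Lemma complete_bigraph_hamiltonian (n : nat) :
  1 < n -> hamiltonian (bigraph_adj [set: 'I_n * 'I_n]).
Proof.
move=> n_gt1; apply/hamiltonianP; rewrite card_sum !card_ord addnn -mul2n.
split; first by rewrite (leq_trans _ (leq_mul (leqnn 2) n_gt1)).
(* The cycle alternates classes: each [inl i] is followed by [inr i], then by the left vertex of the
   next index. *)
pose f (s : seq 'I_n) := flatten [seq [:: inl i : 'I_n + 'I_n; inr i] | i <- s].
have f_path s i j : path (bigraph_adj [set: 'I_n * 'I_n]) (inr j)
  (rcons (f s) (inl i)).
  by elim: s j => /= [|k s IHs] j; rewrite /= !inE //= IHs.
have f_size s : size (f s) = 2 * size s.
  by elim: s => // i s IHs; rewrite /= IHs mulnS.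
have f_mem (v : 'I_n + 'I_n) : v \in f (enum 'I_n).
  apply/flatten_mapP; case: v => i; exists i; rewrite ?mem_enum //.
    by rewrite mem_head.
  by rewrite !inE eqxx orbT.
exists (f (enum 'I_n)); split=> //.
  by case: (enum 'I_n) => //= i s; rewrite inE f_path.
(* Pigeonhole: a sequence that covers all [2 * n] vertices and has length [2 * n] repeats none. *)
apply: (leq_size_uniq (enum_uniq {: 'I_n + 'I_n})) => [v|];
  first by rewrite f_mem.
by rewrite f_size size_enum_ord -cardE card_sum !card_ord addnn mul2n.
Qed.

(** The induction starts at the complete graph. A Hamiltonian cycle of [G] plus a missing edge
    either avoids that edge or leaves a Hamiltonian path between its ends, which the closing lemma
    turns into a cycle of [G]. *)
Lemma bigraph_hamiltonian {n s : nat} (G : bigraph n n) :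
    1 < n ->
    (forall i, 2 * s <= #|[set j | (i, j) \in G]|) ->
    (forall j, 2 * s <= #|[set i | (i, j) \in G]|) ->
    (forall A B : {set 'I_n}, s <= #|A| -> s <= #|B| ->
       exists a b, [/\ a \in A, b \in B & (a, b) \in G]) ->
  hamiltonian (bigraph_adj G).
Proof.
move=> n_gt1; have [k leGk] := ubnP #|~: G|.
elim: k G leGk => // k IHk G leGk degl degr no_hole.
have [->|] := eqVneq G setT; first exact: complete_bigraph_hamiltonian.
rewrite -subTset => /subsetPn[[i j] _ ijG].
have /hamiltonianP[T_gt2 [c [cG' Uc allc]]] :
    hamiltonian (bigraph_adj ((i, j) |: G)).
  apply: IHk.
  - rewrite -ltnS (leq_trans _ leGk) // ltnS proper_card //.
    apply/properP; split; first by rewrite setCS subsetUr.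
    by exists (i, j); rewrite !inE ?eqxx // orbF.
  - move=> a; apply: leq_trans (degl a) (subset_leq_card _).
    by apply/subsetP=> b; rewrite !inE orbC => ->.
  - move=> b; apply: leq_trans (degr b) (subset_leq_card _).
    by apply/subsetP=> a; rewrite !inE orbC => ->.
  - move=> A B sA sB; have [a [b [aA bB ab]]] := no_hole A B sA sB.
    by exists a, b; rewrite !inE ab orbT.
have sz : size c = #|{: 'I_n + 'I_n}|.
  by rewrite -(card_uniqP Uc) (eq_card (B := predT)) // => v; rewrite allc.
apply/hamiltonianP; split=> //.
have cyc_drop := cycle_drop_edge (bigraph_adj_sym n n G) (isT : inl i != inr j).
have [|u v|cG|[p [Gp lastp pc]]] := cyc_drop _ _ (allc _) (allc _) _ Uc _ cG'.
- by rewrite sz.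
- case: u v => [a|b] [a'|b'] //=; rewrite !inE xpair_eqE.
    by case/orP=> [/andP[/eqP-> /eqP->]|->]; rewrite ?eqxx ?orbT.
  by case/orP=> [/andP[/eqP-> /eqP->]|->]; rewrite ?eqxx ?orbT.
- by exists c.
have Up : uniq (inl i :: p) by rewrite (perm_uniq pc).
have allp v : v \in inl i :: p by rewrite (perm_mem pc).
pose col (v : 'I_n + 'I_n) := if v is inr _ then true else false.
have [||||||c' [pc' Gc']] :=
    @hamiltonian_path_close _ _ col s _ _ (bigraph_adj_sym n n G) _ _ _ _ _ _ Gp
      Up allp.
- by case=> [a|b] [a'|b'].
- by [].
- by rewrite lastp.
- move=> A B sA sB colA colB.
  have cardA : #|inl @^-1: A| = #|A|.
    rewrite -(card_imset _ (@inl_inj 'I_n 'I_n)); apply: eq_card => v.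
    apply/imsetP/idP=> [[a + ->]|vA]; first by rewrite inE.
    by case: v vA (colA _ vA) => // a aA _; exists a; rewrite ?inE.
  have cardB : #|inr @^-1: B| = #|B|.
    rewrite -(card_imset _ (@inr_inj 'I_n 'I_n)); apply: eq_card => v.
    apply/imsetP/idP=> [[b + ->]|vB]; first by rewrite inE.
    by case: v vB (colB _ vB) => // b bB _; exists b; rewrite ?inE.
  have [||a [b [aA bB ab]]] := no_hole (inl @^-1: A) (inr @^-1: B).
  - by rewrite cardA.
  - by rewrite cardB.
  by exists (inl a), (inr b); move: aA bB; rewrite !inE.
- apply: leq_trans (degl i) _; rewrite -(card_imset _ (@inr_inj 'I_n 'I_n)).
  by apply/subset_leq_card/subsetP=> _ /imsetP[b + ->]; rewrite !inE.
- rewrite lastp; apply: leq_trans (degr j) _.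
  rewrite -(card_imset _ (@inl_inj 'I_n 'I_n)).
  by apply/subset_leq_card/subsetP=> _ /imsetP[a + ->]; rewrite !inE.
exists c'; split=> // [|v]; first by rewrite (perm_uniq pc').
by rewrite (perm_mem pc').
Qed.

(** * Counting non-Hamiltonian graphs *)

Lemma card_bigraph_avoid (n m : nat) (F : {set 'I_n * 'I_m}) :
  #|[set G : bigraph n m | [disjoint G & F]]| = 2 ^ (n * m - #|F|).
Proof.
have -> : [set G : bigraph n m | [disjoint G & F]] = powerset (~: F).
  by apply/setP=> G; rewrite !inE disjoints_subset.
rewrite card_powerset; congr (2 ^ _).
have <- : #|{: 'I_n * 'I_m}| = n * m by rewrite card_prod !card_ord.
by rewrite -(cardsC F) addKn.
Qed.

(** The union bound with denominators cleared, so that it stays in the natural numbers. *)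
Lemma leq_card_bigcup_mul {I T : finType} {P : pred I} {F : I -> {set T}}
    {a N : nat} :
  (forall i, P i -> #|F i| * a <= N) ->
  #|\bigcup_(i | P i) F i| * a <= #|I| * N.
Proof.
move=> FN; apply: (@leq_trans (\sum_(i | P i) N)); last first.
  by rewrite sum_nat_const leq_mul2r max_card orbT.
elim/big_rec2: _ => [|i c A Pi leA]; first by rewrite cards0.
apply: leq_trans (leq_mul (leq_card_setU _ _) (leqnn _)) _.
by rewrite mulnDl leq_add ?FN.
Qed.

(** Enumerate [A] and pad with [x0] up to length [k]; only the inclusion matters. *)
Lemma sub_tuple {T : finType} (x0 : T) {k : nat} {A : {set T}} :
  #|A| <= k -> exists t : k.-tuple T, {subset A <= t}.
Proof.
move=> Ak; have sz : size (enum A ++ nseq (k - #|A|) x0) == k.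
  by rewrite size_cat size_nseq -cardE subnKC.
by exists (Tuple sz) => v vA; rewrite mem_cat mem_enum vA.
Qed.

Lemma nonhamiltonian_lower_bound {n : nat} : 0 < n ->
  2 ^ (n * n)
    <= #|[set G : bigraph n n | ~~ hamiltonian (bigraph_adj G)]| * 2 ^ n.
Proof.
(* [F] consists of all [n] possible edges at [inl i0]; avoiding it isolates that vertex, which then
   has no successor on a cycle. *)
move=> n_gt0; pose i0 := Ordinal n_gt0; pose F := setX [set i0] [set: 'I_n].
have cardF : #|F| = n by rewrite cardsX cards1 cardsT card_ord mul1n.
have -> : 2 ^ (n * n) = #|[set G : bigraph n n | [disjoint G & F]]| * 2 ^ n.
  by rewrite card_bigraph_avoid cardF -expnD subnK // leq_pmulr.
rewrite leq_mul2r; apply/orP; right; apply/subset_leq_card/subsetP=> G.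
rewrite !inE => dGF; apply/hamiltonianP=> -[_ [c [cG _ allc]]].
have := next_cycle cG (allc (inl i0)); case: (next _ _) => //= j i0jG.
by have := disjointFr dGF i0jG; rewrite !inE eqxx.
Qed.

(** Low degrees cost at most [2 * n ^ (2 * s + 1)] events of probability at most [2 ^ (2 * s - n)];
    empty pairs of [s]-sets cost at most [2 ^ (2 * n)] events of probability at most
    [2 ^ (- 3 * n)]. *)
Lemma nonhamiltonian_upper_bound {n s : nat} : 1 < n -> 3 * n <= s * s ->
  #|[set G : bigraph n n | ~~ hamiltonian (bigraph_adj G)]| * 2 ^ n
    <= 2 ^ (n * n) * (2 * n) ^ (2 * s + 2).
Proof.
move=> n_gt1 ns; have n_gt0 : 0 < n by apply: ltnW.
pose i0 := Ordinal n_gt0; pose k := 2 * s.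
pose avoid (F : {set 'I_n * 'I_n}) := [set G : bigraph n n | [disjoint G & F]].
have avoidP (F : {set 'I_n * 'I_n}) a b :
  a <= #|F| + b -> #|avoid F| * 2 ^ a <= 2 ^ (n * n) * 2 ^ b.
  move=> aF; rewrite card_bigraph_avoid -!expnD leq_exp2l //.
  have Fnn : #|F| <= n * n.
    by rewrite (leq_trans (max_card _)) // card_prod card_ord.
  by rewrite -(leq_add2r #|F|) addnAC subnK // -addnA leq_add2l addnC.
(* A vertex has at most [k] neighbours iff some [k]-tuple contains them all, so
   small degrees are a union over tuples of events avoiding one fixed set. *)
pose row it := setX [set (it : 'I_n * k.-tuple 'I_n).1] (~: [set j in it.2]).
pose col it := setX (~: [set i in (it : 'I_n * k.-tuple 'I_n).2]) [set it.1].
pose hole AB := setX (AB : {set 'I_n} * {set 'I_n}).1 AB.2.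
pose big AB := (s <= #|(AB : {set 'I_n} * {set 'I_n}).1|) && (s <= #|AB.2|).
(* A tuple may repeat entries, so its complement has at least [n - k] elements. *)
have tupleC (t : k.-tuple 'I_n) : n <= #|~: [set j in t]| + k.
  rewrite -[n in n <= _]card_ord -(cardsC [set j in t]) addnC leq_add2l.
  by rewrite cardsE (leq_trans (card_size _)) // size_tuple.
pose N := 2 ^ (n * n) * 2 ^ k.
have sub : [set G : bigraph n n | ~~ hamiltonian (bigraph_adj G)] \subset
    \bigcup_it avoid (row it) :|: \bigcup_it avoid (col it)
      :|: \bigcup_(AB | big AB) avoid (hole AB).
  apply/subsetP=> G; rewrite inE; apply: contraNT; rewrite !inE !negb_or.
  case/andP=> /andP[/bigcupP noRow /bigcupP noCol /bigcupP noHole].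
  apply: (bigraph_hamiltonian (s := s)) => // [i|j|A B sA sB].
  - rewrite leqNgt; apply/negP=> /ltnW /(sub_tuple i0)[t tP]; apply: noRow.
    exists (i, t) => //; rewrite inE disjoints_subset;
      apply/subsetP=> -[a b] abG.
    rewrite !inE; case: eqP => //= Ea; rewrite negbK; apply: tP.
    by rewrite inE -Ea.
  - rewrite leqNgt; apply/negP=> /ltnW /(sub_tuple i0)[t tP]; apply: noCol.
    exists (j, t) => //; rewrite inE disjoints_subset;
      apply/subsetP=> -[a b] abG.
    rewrite !inE andbC; case: eqP => //= Eb; rewrite negbK; apply: tP.
    by rewrite inE -Eb.
  - have /existsP[[a b] /and3P[/= aA bB abG]] :
        [exists ab : 'I_n * 'I_n, [&& ab.1 \in A, ab.2 \in B & ab \in G]].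
      apply: contra_notT noHole => /existsPn noab; exists (A, B);
        first exact/andP.
      rewrite inE disjoints_subset; apply/subsetP=> ab abG; rewrite !inE.
      by have := noab ab; rewrite abG andbT.
    by exists a, b.
apply: leq_trans (leq_mul (subset_leq_card sub) (leqnn _)) _.
apply: leq_trans (leq_mul (leq_card_setU _ _) (leqnn _)) _; rewrite mulnDl.
(* Of the [3 * n] absent edges, [2 * n] pay for the choice of the pair and [n] for the factor
   [2 ^ n]. *)
have holes : #|\bigcup_(AB | big AB) avoid (hole AB)| * 2 ^ n <= 2 ^ (n * n).
  have card_pairs : #|{: {set 'I_n} * {set 'I_n}}| = 2 ^ (n + n).
    by rewrite card_prod -cardsT -powersetT card_powerset cardsT card_ord expnD.
  rewrite -(leq_pmul2l (expn_gt0 2 (n + n))) mulnCA -expnD -card_pairs.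
  apply: leq_card_bigcup_mul => AB /andP[sA sB].
  rewrite -[2 ^ (n * n)]muln1 -(expn0 2) avoidP // addn0 cardsX.
  by rewrite (leq_trans _ (leq_mul sA sB)) // (leq_trans _ ns) // !mulSn addn0
    addnA.
have lines (F : 'I_n * k.-tuple 'I_n -> {set 'I_n * 'I_n}) :
    (forall it, n <= #|F it| + k) ->
    #|\bigcup_(it : 'I_n * k.-tuple 'I_n) avoid (F it)| * 2 ^ n <= n ^ k.+1 * N.
  move=> Fk; have <- : #|{: 'I_n * k.-tuple 'I_n}| = n ^ k.+1.
    by rewrite card_prod card_tuple !card_ord expnS.
  by apply: leq_card_bigcup_mul => it _; apply: avoidP.
have rows : #|\bigcup_it avoid (row it)| * 2 ^ n <= n ^ k.+1 * N.
  by apply: lines => it; rewrite cardsX cards1 mul1n.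
have cols : #|\bigcup_it avoid (col it)| * 2 ^ n <= n ^ k.+1 * N.
  by apply: lines => it; rewrite cardsX cards1 muln1.
have {rows cols}lines_le :
    #|\bigcup_it avoid (row it) :|: \bigcup_it avoid (col it)| * 2 ^ n
    <= 2 ^ (n * n) * (2 * n) ^ k.+1.
  apply: leq_trans (leq_mul (leq_card_setU _ _) (leqnn _)) _.
  rewrite mulnDl (leq_trans (leq_add rows cols)) // addnn -mul2n.
  by rewrite expnMn [2 ^ k.+1]expnS /N [n ^ _ * _]mulnCA mulnCA
    -[2 * _ * _]mulnA [2 ^ k * _]mulnC.
apply: leq_trans (leq_add lines_le holes) _.
rewrite -{2}[2 ^ (n * n)]muln1 -mulnDr leq_mul2l; apply/orP; right.
(* The holes contribute the summand 1, absorbed by [(2n)^(k+1) + 1 <= 2 (2n)^(k+1) <=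
   (2n)^(k+2)]. *)
have n2_gt0 : 0 < (2 * n) ^ k.+1 by rewrite expn_gt0 muln_gt0 n_gt0.
rewrite addn2 [X in _ <= X]expnS (leq_trans (leq_add (leqnn _) n2_gt0)) //.
by rewrite addnn -mul2n leq_mul2r leq_pmulr // orbT.
Qed.

(* Probabilities and asymptotics *)
From mathcomp Require Import all_order all_algebra.
From mathcomp Require Import all_classical all_reals all_analysis.
From mathcomp Require Import lra ring.
Import Order.TTheory GRing.Theory Num.Theory.
Import numFieldNormedType.Exports.
Local Open Scope classical_set_scope.
Local Open Scope ring_scope.

Lemma cardC_bigraph {n m : nat} (A : pred (bigraph n m)) :
  (#|A| + #|predC A| = 2 ^ (n * m))%N.
Proof.
by rewrite cardC -cardsT -powersetT card_powerset cardsT card_prod !card_ord.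
Qed.

(** Present and absent edges weigh the same at [p = 1/2], so the measure is uniform and the counts
    above apply. *)
Lemma bigraph_prob_half (R : realType) (n m : nat) (A : pred (bigraph n m)) :
  bigraph_prob (2^-1 : R) A = #|A|%:R / 2 ^+ (n * m).
Proof.
rewrite /bigraph_prob (eq_bigr (fun=> (2 ^+ (n * m))^-1)) => [|G _].
  by rewrite sumr_const mulr_natl.
have half : 1 - 2^-1 = 2^-1 :> R by lra.
rewrite /bigraph_weight (eq_bigr (fun=> 2^-1)) => [|e _];
  last by rewrite half if_same.
by rewrite prodr_const card_prod !card_ord exprVn.
Qed.

Lemma cvg_inv_sqrt_sqrt (R : realType) :
  (Num.sqrt (Num.sqrt (n%:R : R)))^-1 @[n --> \oo] --> (0 : R).
Proof.
under eq_fun do rewrite -sqrtrV ?sqrtr_ge0 // -sqrtrV //.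
have -> : (0 : R) = Num.sqrt (Num.sqrt 0) by rewrite !sqrtr0.
apply: continuous_cvg; first exact: sqrt_continuous.
apply: continuous_cvg; first exact: sqrt_continuous.
apply: (proj2 (gtr0_cvgV0 _)) (@cvgr_idn R).
by near=> n; rewrite ltr0n; near: n; exists 1%N.
Unshelve. all: by end_near.
Qed.

(** With [t] the fourth root of [n], take [s] just above [2 * t ^ 2]. Then [2 * s + 2 <= 8 * t ^ 2],
    and [ln u <= u - 1] gives [ln (2 * n) <= 5 * t]; the product has order [n^(3/4)], which is
    [o(n)]. *)
Lemma hole_size_exists (R : realType) (n : nat) : (0 < n)%N ->
  let t := Num.sqrt (Num.sqrt (n%:R : R)) in
  exists s : nat, (3 * n <= s * s)%N /\
    (2 * s + 2)%:R * ln ((2 * n)%:R : R) <= 40 * t ^+ 3.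
Proof.
move=> n_gt0 t.
have n_ge1 : 1 <= n%:R :> R by rewrite ler1n.
have t2 : t ^+ 2 = Num.sqrt n%:R by rewrite sqr_sqrtr // sqrtr_ge0.
have t4 : t ^+ 4 = n%:R.
  by rewrite (exprM t 2 2) t2 sqr_sqrtr // (le_trans _ n_ge1).
have t_ge1 : 1 <= t by rewrite -(@expr_ge1 _ 4) ?sqrtr_ge0 // t4.
have t_gt0 : 0 < t by apply: lt_le_trans t_ge1.
pose s := (Num.truncn (2 * t ^+ 2)).+1.
have s_gt : 2 * t ^+ 2 < s%:R by apply: truncnS_gt.
have s_le : s%:R <= 2 * t ^+ 2 + 1.
  rewrite /s -natr1 lerD2r; suff /truncn_itv/andP[] : 0 <= 2 * t ^+ 2 by [].
  by rewrite mulr_ge0 // exprn_ge0 // ltW.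
exists s; split.
  by rewrite -(ler_nat R) !natrM -t4; nra.
have ln_le (u : R) : 0 < u -> ln u <= u - 1.
  by move=> u0; have := @le_ln1Dx R (u - 1); rewrite addrCA subrr addr0; apply;
    lra.
have -> : ln ((2 * n)%:R : R) = ln 2 + 4 * ln t.
  by rewrite natrM -t4 lnM ?posrE ?exprn_gt0 // lnXn // mulr_natl.
have l2 := ln_le 2 ltac:(lra); have lt := ln_le t t_gt0.
have l2_0 : 0 <= ln 2 :> R by apply: ln_ge0; lra.
have lt_0 : 0 <= ln t by apply: ln_ge0.
have ss : (2 * s + 2)%:R <= 8 * t ^+ 2 by rewrite natrD natrM; nra.
have ll : ln 2 + 4 * ln t <= 5 * t by lra.
apply: le_trans (ler_pM _ _ ss ll) _ => //; first by lra.
by rewrite !exprS; lra.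
Qed.

Theorem theorem9 (R : realType) :
  exists eps : nat -> R,
    eps n @[n --> \oo] --> (0 : R) /\
    forall n : nat, (0 < n)%N ->
      bigraph_prob (2^-1 : R)
        (fun G : bigraph n n => hamiltonian (bigraph_adj G)) =
      1 - 2 `^ (- ((1 + eps n) * n%:R)).
Proof.
pose K n := #|[pred G : bigraph n n | ~~ hamiltonian (bigraph_adj G)]|.
pose f n : R := (K n)%:R / 2 ^+ (n * n).
(* Obtained by solving [f n = 2 ^ (- (1 + eps n) * n)] for [eps n], where [f n] is the failure
   probability; the identity is then exact and only the limit is at stake. *)
pose eps n : R := - (ln (f n) + n%:R * ln 2) / (n%:R * ln 2).
have KE n : K n = #|finset (fun G : bigraph n n =>
  ~~ hamiltonian (bigraph_adj G))|.
  by rewrite cardsE.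
have ln2_gt0 : 0 < ln 2 :> R by apply: ln_gt0; lra.
have f_ge n : (0 < n)%N -> 2 ^- n <= f n.
  move=> n_gt0; have := nonhamiltonian_lower_bound n_gt0; rewrite -KE.
  rewrite -(ler_nat R) natrM !natrX => Kn.
  by rewrite ler_pdivlMr ?exprn_gt0 // mulrC ler_pdivrMr ?exprn_gt0.
have f_gt0 n : (0 < n)%N -> 0 < f n.
  by move=> /f_ge; apply: lt_le_trans; rewrite invr_gt0 exprn_gt0.
exists eps; split; last first.
  move=> n n_gt0; transitivity (1 - f n).
    rewrite bigraph_prob_half /f /K; apply/eqP.
    have two_gt0 : 0 < 2 ^+ (n * n) :> R by rewrite exprn_gt0.
    rewrite eq_sym subr_eq -mulrDl -natrD cardC_bigraph.
    by rewrite natrX divff // gt_eqF.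
  congr (1 - _); rewrite /powR; case: eqP => [|_]; first by lra.
  rewrite -[LHS]lnK ?posrE ?f_gt0 //; congr expR; rewrite /eps.
  have n0 : n%:R != 0 :> R by rewrite pnatr_eq0 -lt0n.
  by field; rewrite n0 gt_eqF.
have eps_le n : (0 < n)%N -> eps n <= 0.
  move=> n_gt0; rewrite /eps mulNr oppr_le0 divr_ge0 //; last first.
    by rewrite mulr_ge0 // ltW.
  rewrite mulr_natl -lnXn // -lnM ?posrE ?f_gt0 ?exprn_gt0 //; apply: ln_ge0.
  by rewrite -ler_pdivrMr ?exprn_gt0 // div1r f_ge.
(* Dividing the bound [40 * t ^ 3] by [n * ln 2 = t ^ 4 * ln 2] leaves a multiple of [1 / t]. *)
have eps_ge n : (1 < n)%N ->
    - (40 / ln 2) * (Num.sqrt (Num.sqrt n%:R))^-1 <= eps n.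
  move=> n_gt1; have n_gt0 : (0 < n)%N by apply: ltnW.
  have [s [ns sle]] := @hole_size_exists R n n_gt0.
  set t := Num.sqrt _ in sle *.
  have t4 : t ^+ 4 = n%:R by rewrite (exprM t 2 2) !sqr_sqrtr ?sqrtr_ge0.
  have t_gt0 : 0 < t by rewrite !sqrtr_gt0 ltr0n.
  have := nonhamiltonian_upper_bound n_gt1 ns; rewrite -KE.
  rewrite -(ler_nat R) !natrM !natrX => Kn.
  have fn : f n * 2 ^+ n <= (2 * n)%:R ^+ (2 * s + 2).
    by rewrite mulrAC ler_pdivrMr ?exprn_gt0 // [leRHS]mulrC.
  have lnf : ln (f n) + n%:R * ln 2 <= 40 * t ^+ 3.
    apply: le_trans sle; rewrite mulr_natl [(2 * s + 2)%:R * _]mulr_natl -!lnXn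
      //.
      rewrite -lnM ?posrE ?f_gt0 ?exprn_gt0 // ler_ln ?posrE //.
        by rewrite mulr_gt0 ?f_gt0 ?exprn_gt0.
      by rewrite exprn_gt0 // ltr0n muln_gt0.
    by rewrite ltr0n muln_gt0.
  rewrite -t4 in lnf; rewrite /eps !mulNr lerN2 -t4 ler_pdivrMr ?mulr_gt0
    ?exprn_gt0 //.
  apply: le_trans lnf _; rewrite le_eqVlt; apply/orP; left; apply/eqP.
  by field; rewrite !gt_eqF.
apply: (@squeeze_cvgr _ _ _ _ (fun n =>
  - (40 / ln 2) * (Num.sqrt (Num.sqrt n%:R))^-1) (fun=> 0)).
- near=> n; have n_gt1 : (1 < n)%N by near: n; exists 2%N.
  by rewrite eps_ge // eps_le // ltnW.
- rewrite -[X in _ --> X](mulr0 (- (40 / ln 2))); apply: cvgM;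
  first exact: cvg_cst.
  exact: cvg_inv_sqrt_sqrt.
- exact: cvg_cst.
Unshelve. all: by end_near.
Qed.
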